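(* Let $L:P^D\to P$ be an $\mathcal S$-polynomial operator, let $k\in\mathbb N$, fix a $k$-th dual operator $L_k$ and a $k$-th bidual operator $M_k$ of $L$, and assume that $L_k$ is closable, its closure having domain $\mathcal D(L_k)$. Let $(\lambda_t)_{t\ge0}$ be an $\mathcal S$-valued polynomial process corresponding to $L$. Suppose that $\lambda_t^{\otimes j}$ is Dunford integrable for all $j\in\{0,\dots,k\}$ and $t>0$, and set $$\vec m_t:=(1,\mathbb E[\lambda_t],\dots,\mathbb E[\lambda_t^{\otimes k}]).$$ Then $(\vec m_t)_{t\ge0}$ is an $\mathcal E$-weak solution of the $(k+1)$-dimensional system of linear ODEs $$\partial_t\vec m_t=M_k\vec m_t,\qquad \vec m_0=(1,\lambda_0,\dots,\lambda_0^{\otimes k}),$$ where $\mathcal E:=\{\vec a\in\mathcal D(L_k): N^{p_{\vec a}}\text{ is a true martingale}\}$.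
   Context: **Tensor notation.** $B$ is a real Banach space with dual $B^*$. For $k\ge1$, $B^{\otimes k}$ is the $k$-fold symmetric algebraic tensor product, i.e. the linear span of $\{y^{\otimes k}:y\in B\}$, equipped with (the restriction of) a fixed crossnorm $\|\cdot\|_\times$ on the $k$-fold algebraic tensor product, i.e. a norm with $\|y_1\otimes\dots\otimes y_k\|_\times=\prod\|y_i\|$ and for which $a_1\otimes\dots\otimes a_k$ ($a_i\in B^*$) has dual norm $\prod\|a_i\|_*$. $(B^{\otimes k})^*$ is its dual, with dual norm $\|\cdot\|_{*k}$, and $(B^{\otimes k})^{**}$ its bidual, containing $B^{\otimes k}$ canonically; $\langle a,y\rangle$ denotes the pairing of $a\in(B^{\otimes k})^*$ with $y\in(B^{\otimes k})^{**}$. For $k=0$ all these spaces are $\mathbb R$ and $y^{\otimes0}=1$. For $y\in B$, $\overline y:=(1,y,\dots,y^{\otimes k})$. For $\vec a\in\bigoplus_{j=0}^k(B^{\otimes j})^*$ and $\vec y\in\bigoplus_{j=0}^k(B^{\otimes j})^{**}$, $(\vec a\cdot\vec y):=\sum_{j=0}^k\langle a_j,y_j\rangle$. **Polynomials.** A polynomial on $B$ is a map $p(y)=(\vec a\cdot\overline y)$ for some $k$ and $\vec a\in\bigoplus_{j=0}^k(B^{\otimes j})^*$; $\deg p$ is the largest $j$ with $a_j\ne0$ ($-\infty$ if $p=0$). $P$ is the algebra of polynomials on $B$. $D\subseteq B^*$ is a linear subspace, $D^{\otimes j}:=\mathrm{span}\{a^{\otimes j}:a\in D\}\subseteq(B^{\otimes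 j})^*$ ($D^{\otimes0}=\mathbb R$), and $P^D=\{y\mapsto(\vec a\cdot\overline y):k\in\mathbb N_0,\ a_j\in D^{\otimes j}\}$. **Polynomial operators, dual and bidual operators.** Let $\mathcal S\subseteq B$. A linear operator $L:P^D\to P$ is $\mathcal S$-polynomial if for every $p\in P^D$ there is $q\in P$ with $q|_{\mathcal S}=Lp|_{\mathcal S}$ and $\deg q\le\deg p$. A $k$-th dual operator is a linear operator $L_k:\bigoplus_{j=0}^kD^{\otimes j}\to\bigoplus_{j=0}^k(B^{\otimes j})^*$ such that $Lp(y)=(L_k\vec a\cdot\overline y)$ for all $y\in\mathcal S$ whenever $p(y)=(\vec a\cdot\overline y)$. If $L_k$ is closable, its closure is still denoted $L_k$, with domain $\mathcal D(L_k)\subseteq\bigoplus_{j=0}^k(B^{\otimes j})^*$. For $\vec a\in\mathcal D(L_k)$ put $p_{\vec a}(y):=(\vec a\cdot\overline y)$ and $Lp_{\vec a}(y):=(L_k\vec a\cdot\overline y)$. Let $\mathcal D_k$ be the linear span of those $\overline y$, $y\in\mathcal S$, for which there is $C_y\in\mathbb R$ with $|Lp_{a_i}(y)|\le C_y\|a_i\|_{*i}$ for all $a_i\in D^{\otimes i}$, $i\in\{0,\dots,k\}$, where $p_{a_i}(y):=\langle a_i,y^{\otimes i}\rangle$. A $k$-th bidual operator is a linear operator $M_k:\mathcal D_k\to\bigoplus_{j=0}^k(B^{\otimes j})^{**}$ such that $Lp(y)=(\vec a\cdot M_k\overline y)$ for all $\vec a\in\bigoplus_{j=0}^kD^{\otimes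 j}$, where $p(y)=(\vec a\cdot\overline y)$ (for $y\in \mathcal S$ with $\overline y\in\mathcal D_k$). **Polynomial processes.** On a filtered probability space $(\Omega,\mathcal F,(\mathcal F_t)_{t\ge0},\mathbb P)$, a $B$-valued process is a map $\lambda:\mathbb R_+\times\Omega\to B$ such that $\langle a,\lambda_t^{\otimes n}\rangle$ is $\mathcal F_t$-measurable for all $n\in\mathbb N$, $a\in(B^{\otimes n})^*$, $t\ge0$. An $\mathcal S$-valued polynomial process corresponding to an $\mathcal S$-polynomial $L$ is an $\mathcal S$-valued process $\lambda$ solving the martingale problem for $L$ with some initial condition $y_0\in\mathcal S$: $\lambda_0=y_0$ a.s.; for each $p\in P^D$ the processes $p(\lambda_t)$ and $Lp(\lambda_t)$ have càdlàg versions; and $N^p_t:=p(\lambda_t)-p(\lambda_0)-\int_0^tLp(\lambda_s)\,ds$ is a local martingale for each $p\in P^D$. The same formula defines $N^{p_{\vec a}}$ for $\vec a\in\mathcal D(L_k)$. **Dunford integral.** A map $\xi:\Omega\to B^{\otimes j}$ with $\langle a,\xi\rangle$ measurable for all $a\in(B^{\otimes j})^*$ is Dunford integrable if there is $m\in(B^{\otimes j})^{**}$ with $\mathbb E[|\langle a,\xi\rangle|]<\infty$ and $\mathbb E[\langle a,\xi\rangle]=\langle a,m\rangle$ for all $a\in(B^{\otimes j})^*$; then $\mathbb E[\xi]:=m$. **Weak solutions.** For $\mathcal H\subseteq\mathcal D(L_k)$, a function $t\mapsto\vec m_t\in\bigoplus_{j=0}^k(B^{\otimes j})^{**}$ is an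 $\mathcal H$-weak solution of $\partial_t\vec m_t=M_k\vec m_t$, $\vec m_0=\vec m$, if $(\vec a\cdot\vec m_t)=(\vec a\cdot\vec m)+\int_0^t(L_k\vec a\cdot\vec m_s)\,ds$ for every $t>0$ and $\vec a\in\mathcal H$.
   Formalization: For a in E, the formal ''N^{p_a} is a true martingale'' also asks that Lp_a(λ) have a jointly measurable version that is dP⊗ds-integrable on Ω×[0,t] for every t; without this integrability the claim fails, since E[∫Lp_a(λ_s)ds] and ∫E[Lp_a(λ_s)]ds may differ. *)

(* Defs.v *)
From HB Require Import structures.
From mathcomp Require Import all_boot all_order all_algebra.
From mathcomp Require Import all_classical all_reals all_analysis.

Set Implicit Arguments.
Unset Strict Implicit.
Unset Printing Implicit Defensive.

Import Order.TTheory GRing.Theory Num.Theory.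
Import numFieldNormedType.Exports.

Local Open Scope classical_set_scope.
Local Open Scope ring_scope.

Section Span.
Context {R : realType} {V : lmodType R}.

Definition span (A : set V) : set V :=
  [set x | exists n (c : 'I_n -> R) (v : 'I_n -> V),
    (forall i, A (v i)) /\ x = \sum_i c i *: v i].

Lemma span_submod (A : set V) :
  subsemimod_closed [pred x | `[< span A x >]].
Proof.
apply: GRing.submod_closed_semi; split.
  apply/asboolP; exists 0%N, (fun=> 0), (fun=> 0).
  by rewrite big_ord0; split => [[]|].
move=> r _ _ /asboolP[n [c [v [Av ->]]]] /asboolP[m [e [w [Aw ->]]]].
apply/asboolP; exists (n + m)%N.
exists (fun i : 'I_(n + m) => match fintype.split i with inl j => r * c j | inr j => e j end).
exists (fun i : 'I_(n + m) => match fintype.split i with inl j => v j | inr j => w j end).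
split; first by move=> i; case: (fintype.split i).
rewrite big_split_ord/= scaler_sumr; congr (_ + _); apply: eq_bigr => i _.
  by rewrite (unsplitK (inl i)) scalerA.
by rewrite (unsplitK (inr i)).
Qed.

Lemma sub_span (A : set V) : A `<=` span A.
Proof.
move=> x Ax; exists 1%N, (fun=> 1), (fun=> x); split => //.
by rewrite big_ord1 scale1r.
Qed.

Definition spanned (A : set V) := {x : V | `[< span A x >]}.
HB.instance Definition _ (A : set V) := SubChoice.on (spanned A).
HB.instance Definition _ (A : set V) :=
  @GRing.SubChoice_isSubLmodule.Build R V _ (spanned A) (span_submod A).

Definition in_spanned (A : set V) (x : V) (Ax : A x) : spanned A :=
  exist (fun x => `[< span A x >]) x (asboolT (sub_span Ax)).

Lemma sval_spannedP (A : set V) (c : R) (x y : spanned A) :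
  sval (c *: x + y) = c *: sval x + sval y.
Proof. by []. Qed.

End Span.

Section PartialOperators.
Context {R : realType}.

(* A linear operator with a linear domain [A] is a total function whose values
   outside [A] are irrelevant. *)
Definition linear_on (U V : lmodType R) (A : set U) (f : U -> V) :=
  forall (c : R) x y, A x -> A y -> f (c *: x + y) = c *: f x + f y.

Context {U V : normedModType R}.

Definition graph_on (A : set U) (f : U -> V) : set (U * V) :=
  [set (x, f x) | x in A].

Definition closable (A : set U) (f : U -> V) := forall x y y',
  closure (graph_on A f) (x, y) -> closure (graph_on A f) (x, y') -> y = y'.

Definition closure_dom (A : set U) (f : U -> V) : set U :=
  [set x | exists y, closure (graph_on A f) (x, y)].

Definition closure_op (A : set U) (f : U -> V) (x : U) : V :=
  xget 0 [set y | closure (graph_on A f) (x, y)].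

End PartialOperators.

Section Dual.
Context {R : realType}.
Implicit Type V : normedModType R.

Definition is_functional V : set (V -> R) :=
  [set f : V -> R | scalar f /\ continuous f].
Arguments is_functional : clear implicits.

Lemma is_functional_submod V :
  subsemimod_closed [pred f | `[< is_functional V f >]].
Proof.
apply: GRing.submod_closed_semi; split.
  apply/asboolP; split; last by move=> ?; exact: cst_continuous.
  by move=> r x y /=; rewrite mulr0 addr0.
move=> r f g /asboolP[fl fc] /asboolP[gl gc].
apply/asboolP; split => [c x y|x].
  change (r * f (c *: x + y) + g (c *: x + y) =
          c * (r * f x + g x) + (r * f y + g y)).
  by rewrite fl gl !mulrDr !mulrA (mulrC r c) addrACA.
have H := @cvgD _ R^o V (nbhs x) _ (fun z => r * f z) g (r * f x) (g x)
  (@cvgMr _ _ _ _ f r (f x) (fc x)) (gc x).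
exact: H.
Qed.

Definition dual V := {f : V -> R | `[< is_functional V f >]}.
HB.instance Definition _ V := SubChoice.on (dual V).
HB.instance Definition _ V :=
  @GRing.SubChoice_isSubLmodule.Build R (V -> R) _ (dual V)
    (is_functional_submod V).

Definition dual_fun V (f : dual V) : V -> R := sval f.
Coercion dual_fun : dual >-> Funclass.

Lemma dualP V (f g : dual V) : (forall x, f x = g x) -> f = g.
Proof. by move=> fg; apply: val_inj; apply/funext. Qed.

Lemma dual_scalar V (f : dual V) : scalar f.
Proof. by have /asboolP[] := valP f. Qed.

Lemma dual_continuous V (f : dual V) : continuous f.
Proof. by have /asboolP[] := valP f. Qed.

Lemma dual_bounded V (f : dual V) :
  exists M, forall x, `|f x| <= M * `|x|.
Proof.
pose g : {linear V -> R^o} :=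
  HB.pack (dual_fun f : V -> R^o) (GRing.isLinear.Build R V R^o *:%R
    (dual_fun f : V -> R^o) (@dual_scalar V f)).
have /linear_boundedP[M [_ hM]] : bounded_near g (nbhs (0 : V)).
  by apply: continuous_linear_bounded; exact: dual_continuous.
by exists (M + 1) => x; apply: hM; rewrite ltrDl.
Qed.

Lemma bounded_is_functional V (f : V -> R) : scalar f ->
  (exists M, forall x, `|f x| <= M * `|x|) -> is_functional V f.
Proof.
move=> fl [M hM]; split => //.
pose g : {linear V -> R^o} :=
  HB.pack (f : V -> R^o) (GRing.isLinear.Build R V R^o *:%R
    (f : V -> R^o) fl).
apply: (@bounded_linear_continuous _ _ _ g); apply/linear_boundedP.
exists M; split; first exact: num_real.
by move=> r Mr x; rewrite (le_trans (hM x))// ler_wpM2r// ltW.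
Qed.

Definition mk_dual V (f : V -> R) (fl : scalar f)
    (fb : exists M, forall x, `|f x| <= M * `|x|) : dual V :=
  exist (fun f => `[< is_functional V f >]) f
    (asboolT (bounded_is_functional fl fb)).

Definition dual_norm V (f : dual V) : R :=
  sup [set `|f x| | x in [set x | `|x| <= 1]].

Lemma dual0 V (f : dual V) : f 0 = 0.
Proof. by have := dual_scalar f (- 1) 0 0; rewrite scaler0 addr0 mulN1r addNr. Qed.

Lemma dualZ V (f : dual V) c x : f (c *: x) = c * f x.
Proof. by have := dual_scalar f c x 0; rewrite dual0 !addr0. Qed.

Lemma dualD V (f : dual V) x y : f (x + y) = f x + f y.
Proof. by have := dual_scalar f 1 x y; rewrite scale1r mul1r. Qed.

Lemma dual_norm_has_sup V (f : dual V) :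
  has_sup [set `|f x| | x in [set x | `|x| <= 1]].
Proof.
split; first by exists `|f 0|, 0 => //=; rewrite normr0.
have [M hM] := dual_bounded f; exists `|M| => _ [x /= x1 <-].
rewrite (le_trans (hM x))// (@le_trans _ _ (`|M| * `|x|))//.
  by rewrite ler_wpM2r// ler_norm.
by rewrite ler_piMr.
Qed.

Lemma dual_norm_ub V (f : dual V) x : `|x| <= 1 -> `|f x| <= dual_norm f.
Proof.
by move=> x1; apply: sup_upper_bound; [exact: dual_norm_has_sup|exists x].
Qed.

Lemma dual_norm_le V (f : dual V) x : `|f x| <= dual_norm f * `|x|.
Proof.
have [->|x0] := eqVneq x 0; first by rewrite dual0 !normr0 mulr0.
have xgt0 : 0 < `|x| by rewrite normr_gt0.
have : `|f (`|x|^-1 *: x)| <= dual_norm f.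
  by apply: dual_norm_ub; rewrite normrZ normfV normr_id mulVf// normr_eq0.
rewrite dualZ normrM normfV normr_id => h.
by rewrite -ler_pdivrMr// mulrC.
Qed.

Lemma dual_normD V (f g : dual V) :
  dual_norm (f + g) <= dual_norm f + dual_norm g.
Proof.
apply: ge_sup; first by have [] := dual_norm_has_sup (f + g).
move=> _ [x /= x1 <-]; change (`|f x + g x| <= dual_norm f + dual_norm g).
by rewrite (le_trans (ler_normD _ _))// lerD// dual_norm_ub.
Qed.

Lemma dual_normZ_le V c (f : dual V) :
  dual_norm (c *: f) <= `|c| * dual_norm f.
Proof.
apply: ge_sup; first by have [] := dual_norm_has_sup (c *: f).
move=> _ [x /= x1 <-]; change (`|c * f x| <= `|c| * dual_norm f).
by rewrite normrM ler_wpM2l// dual_norm_ub.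
Qed.

Lemma dual_normZ V c (f : dual V) : dual_norm (c *: f) = `|c| * dual_norm f.
Proof.
apply/eqP; rewrite eq_le dual_normZ_le/=.
have [->|c0] := eqVneq c 0.
  rewrite normr0 mul0r (le_trans _ (@dual_norm_ub _ _ 0 _))//.
  by rewrite normr0.
rewrite -ler_pdivlMl ?normr_gt0// -normfV.
by rewrite (le_trans _ (dual_normZ_le _ _))// scalerA mulVf// scale1r.
Qed.

Lemma dual_norm0_eq0 V (f : dual V) : dual_norm f = 0 -> f = 0.
Proof.
move=> f0; apply: dualP => x; change (f x = 0).
by apply/eqP; rewrite -normr_le0 (le_trans (dual_norm_le f x))// f0 mul0r.
Qed.

HB.instance Definition _ V := @Lmodule_isNormed.Build R (dual V)
  (@dual_norm V) (@dual_normD V) (@dual_normZ V) (@dual_norm0_eq0 V).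

Lemma bidual_emb_scalar V (x : V) : scalar (fun f : dual V => f x).
Proof. by []. Qed.

Lemma bidual_emb_bounded V (x : V) :
  exists M, forall f : dual V, `|f x| <= M * `|f|.
Proof. by exists `|x| => f; rewrite mulrC; exact: dual_norm_le. Qed.

Definition bidual_emb V (x : V) : dual (dual V) :=
  mk_dual (bidual_emb_scalar x) (bidual_emb_bounded x).

End Dual.

Section DirectSum.
Context {R : realType} {n : nat}.

Definition dsum (V : 'I_n -> normedModType R) := forall i, V i.

HB.instance Definition _ (V : 'I_n -> normedModType R) :=
  gen_eqMixin (dsum V).
HB.instance Definition _ (V : 'I_n -> normedModType R) :=
  gen_choiceMixin (dsum V).

Variable V : 'I_n -> normedModType R.
Implicit Types x y z : dsum V.

Let zero : dsum V := fun=> 0.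
Let opp x : dsum V := fun i => - x i.
Let add x y : dsum V := fun i => x i + y i.
Let scale (c : R) x : dsum V := fun i => c *: x i.

Let dsum_addA : associative add.
Proof. by move=> x y z; apply: functional_extensionality_dep => i; exact: addrA. Qed.
Let dsum_addC : commutative add.
Proof. by move=> x y; apply: functional_extensionality_dep => i; exact: addrC. Qed.
Let dsum_add0 : left_id zero add.
Proof. by move=> x; apply: functional_extensionality_dep => i; exact: add0r. Qed.
Let dsum_addN : left_inverse zero opp add.
Proof. by move=> x; apply: functional_extensionality_dep => i; exact: addNr. Qed.

HB.instance Definition _ := @GRing.isZmodule.Build (dsum V) zero opp add
  dsum_addA dsum_addC dsum_add0 dsum_addN.

Let dsum_scaleA a b x : scale a (scale b x) = scale (a * b) x.
Proof. by apply: functional_extensionality_dep => i; exact: scalerA. Qed.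
Let dsum_scale1 : left_id 1 scale.
Proof. by move=> x; apply: functional_extensionality_dep => i; exact: scale1r. Qed.
Let dsum_scaleDr : right_distributive scale +%R.
Proof.
by move=> c x y; apply: functional_extensionality_dep => i; exact: scalerDr.
Qed.
Let dsum_scaleDl x : {morph scale^~ x : a b / a + b}.
Proof.
by move=> a b; apply: functional_extensionality_dep => i; exact: scalerDl.
Qed.

HB.instance Definition _ := @GRing.Zmodule_isLmodule.Build R (dsum V) scale
  dsum_scaleA dsum_scale1 dsum_scaleDr dsum_scaleDl.

Definition dsum_norm x : R := \sum_i `|x i|.

Let dsum_normD x y : dsum_norm (x + y) <= dsum_norm x + dsum_norm y.
Proof. by rewrite -big_split/=; apply: ler_sum => i _; exact: ler_normD. Qed.
Let dsum_normZ c x : dsum_norm (c *: x) = `|c| * dsum_norm x.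
Proof. by rewrite mulr_sumr; apply: eq_bigr => i _; exact: normrZ. Qed.
Let dsum_norm0_eq0 x : dsum_norm x = 0 -> x = 0.
Proof.
move=> /eqP; rewrite psumr_eq0// => /allP x0.
apply: functional_extensionality_dep => i; apply/eqP; rewrite -normr_eq0.
by apply: x0; rewrite mem_index_enum.
Qed.

HB.instance Definition _ := @Lmodule_isNormed.Build R (dsum V)
  dsum_norm dsum_normD dsum_normZ dsum_norm0_eq0.

End DirectSum.

Section Tensor.
Context {R : realType}.
Implicit Types (B : normedModType R) (k : nat).

Record mlform B k := MLForm {
  mlfun :> ('I_k -> B) -> R ;
  mlfunP : forall i (y : 'I_k -> B) (c : R) (u v : B),
    mlfun [eta y with i |-> c *: u + v] =
      c * mlfun [eta y with i |-> u] + mlfun [eta y with i |-> v] }.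

(* The multilinear forms separate the points of the algebraic tensor product, so
   y_1 (x) ... (x) y_k can be taken to be evaluation at (y_1, ..., y_k). *)
Definition tens_raw B k (y : 'I_k -> B) : mlform B k -> R := fun phi => phi y.

Definition tensor B k := spanned (range (@tens_raw B k)).
HB.instance Definition _ B k := GRing.Lmodule.on (tensor B k).

Lemma range_tens_raw B k (y : 'I_k -> B) : range (@tens_raw B k) (tens_raw y).
Proof. by exists y. Qed.

Definition tens B k (y : 'I_k -> B) : tensor B k :=
  in_spanned (range_tens_raw y).

Lemma prod_formP B k (a : 'I_k -> dual B) i (y : 'I_k -> B) (c : R) (u v : B) :
  \prod_j a j ([eta y with i |-> c *: u + v] j) =
    c * (\prod_j a j ([eta y with i |-> u] j)) +
    \prod_j a j ([eta y with i |-> v] j).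
Proof.
have upd w : \prod_j a j ([eta y with i |-> w] j) =
    a i w * \prod_(j | j != i) a j (y j).
  rewrite (bigD1 i)//= eqxx; congr (_ * _); apply: eq_bigr => j /negPf ji.
  by rewrite ji.
by rewrite !upd dual_scalar mulrDl mulrA.
Qed.

Definition prod_form B k (a : 'I_k -> dual B) : mlform B k :=
  @MLForm B k (fun y => \prod_j a j (y j)) (prod_formP a).

(* the functional a_1 (x) ... (x) a_k *)
Definition dtens B k (a : 'I_k -> dual B) (x : tensor B k) : R :=
  (sval x : mlform B k -> R) (prod_form a).

Record crossnorm B k := Crossnorm {
  cnorm :> tensor B k -> R ;
  cnormD : forall x y, cnorm (x + y) <= cnorm x + cnorm y ;
  cnormZ : forall (c : R) x, cnorm (c *: x) = `|c| * cnorm x ;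
  cnorm0_eq0 : forall x, cnorm x = 0 -> x = 0 ;
  cnorm_tens : forall y : 'I_k -> B, cnorm (tens y) = \prod_i `|y i| ;
  cnorm_dtens : forall a : 'I_k -> dual B,
    ereal_sup [set (`|dtens a x|)%:E | x in [set x | cnorm x <= 1]] =
      (\prod_i `|a i|)%:E }.

Definition pure_powers B k : set (tensor B k) :=
  range (fun y : B => tens (fun=> y)).

(* For k = 0 this is the line spanned by the empty tensor, of norm 1. *)
Definition symtensor B k (N : crossnorm B k) := spanned (@pure_powers B k).
HB.instance Definition _ B k (N : crossnorm B k) :=
  GRing.Lmodule.on (symtensor N).

Section Norm.
Variables (B : normedModType R) (k : nat) (N : crossnorm B k).

Definition sym_norm (x : symtensor N) : R := N (sval x).

Let sym_normD x y : sym_norm (x + y) <= sym_norm x + sym_norm y.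
Proof. exact: cnormD. Qed.
Let sym_normZ c x : sym_norm (c *: x) = `|c| * sym_norm x.
Proof. exact: cnormZ. Qed.
Let sym_norm0_eq0 x : sym_norm x = 0 -> x = 0.
Proof. by move=> /cnorm0_eq0 x0; exact: val_inj. Qed.

HB.instance Definition _ := @Lmodule_isNormed.Build R (symtensor N)
  sym_norm sym_normD sym_normZ sym_norm0_eq0.

Lemma pure_powersP (y : B) : pure_powers (tens (fun=> y) : tensor B k).
Proof. by exists y. Qed.

Definition tpow (y : B) : symtensor N := in_spanned (pure_powersP y).

Lemma dtens_scalar (a : 'I_k -> dual B) : scalar (dtens a).
Proof. by move=> c x y; rewrite /dtens sval_spannedP. Qed.

Lemma dpow_scalar (a : dual B) :
  scalar (fun x : symtensor N => dtens (fun=> a) (sval x)).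
Proof. by move=> c x y; rewrite sval_spannedP dtens_scalar. Qed.

Lemma cnorm_ge0 (x : tensor B k) : 0 <= N x.
Proof.
have N0 : N 0 = 0 by rewrite -(scale0r 0) cnormZ normr0 mul0r.
have := cnormD N x (- x); rewrite subrr N0.
by rewrite -scaleN1r cnormZ normrN1 mul1r -mulr2n pmulrn_lge0.
Qed.

Lemma dtens_bounded (a : 'I_k -> dual B) (x : tensor B k) :
  `|dtens a x| <= (\prod_i `|a i|) * N x.
Proof.
have [Nx0|Nx0] := eqVneq (N x) 0.
  by rewrite (cnorm0_eq0 Nx0) /dtens /= normr0 mulr_ge0// ?cnorm_ge0// prodr_ge0.
have Nx : 0 < N x by rewrite lt0r Nx0 cnorm_ge0.
rewrite -ler_pdivrMr// mulrC -lee_fin -(cnorm_dtens N a).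
have dZ : dtens a ((N x)^-1 *: x) = (N x)^-1 * dtens a x.
  have := dtens_scalar a (N x)^-1 x 0.
  by rewrite addr0 => ->; rewrite [dtens a 0]/(0 : R) addr0.
apply: ereal_sup_ubound; exists ((N x)^-1 *: x).
  by rewrite /mkset cnormZ gtr0_norm ?invr_gt0// mulVf.
by rewrite dZ normrM gtr0_norm// invr_gt0.
Qed.

Lemma dpow_bounded (a : dual B) :
  exists M, forall x : symtensor N, `|dtens (fun=> a) (sval x)| <= M * `|x|.
Proof. by exists (\prod_(i < k) `|a|) => x; exact: dtens_bounded. Qed.

Definition dpow (a : dual B) : dual (symtensor N) :=
  mk_dual (dpow_scalar a) (dpow_bounded a).

End Norm.

End Tensor.

Section Polynomials.
Context {R : realType} {B : normedModType R} (N : forall j, crossnorm B j).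

Definition dualsum k : normedModType R :=
  dsum (fun j : 'I_k.+1 => (dual (symtensor (N j)) : normedModType R)).

Definition bidualsum k : normedModType R :=
  dsum (fun j : 'I_k.+1 => (dual (dual (symtensor (N j))) : normedModType R)).

Definition dotp k (a : dualsum k) (y : bidualsum k) : R :=
  \sum_(j < k.+1) (y j : dual (dual (symtensor (N j)))) (a j).

Definition bar k (y : B) : bidualsum k :=
  fun j => bidual_emb (tpow (N j) y).

Definition polyf k (a : dualsum k) : B -> R := fun y => dotp a (bar y).

Definition monof j (a : dual (symtensor (N j))) : B -> R :=
  fun y => a (tpow (N j) y).

Definition polys : set (B -> R) := [set p | exists k (a : dualsum k), p = polyf a].

(* The coefficients of a polynomial are unique, so the supremum is the largest
   index of a nonzero coefficient, and -oo for the zero polynomial. *)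
Definition deg (p : B -> R) : \bar R :=
  ereal_sup [set d | exists k (a : dualsum k) (j : 'I_k.+1),
    [/\ p = polyf a, a j <> 0 & d = (j%:R)%:E]].

Definition is_subspace (V : lmodType R) (A : set V) :=
  A 0 /\ forall (c : R) x y, A x -> A y -> A (c *: x + y).

Variable D : set (dual B).

Definition Dpow j : set (dual (symtensor (N j))) :=
  span [set dpow (N j) a | a in D].

Definition Dsum k : set (dualsum k) := [set a | forall j : 'I_k.+1, Dpow (a j)].

Definition Dpolys : set (B -> R) :=
  [set p | exists k (a : dualsum k), Dsum a /\ p = polyf a].

Variable S : set B.

Record S_polynomial (L : (B -> R) -> (B -> R)) : Prop := {
  S_polynomial_polys : forall p, Dpolys p -> polys (L p) ;
  S_polynomial_linear : linear_on Dpolys L ;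
  S_polynomial_deg : forall p, Dpolys p ->
    exists q, [/\ polys q, forall y, S y -> q y = L p y & (deg q <= deg p)%E] }.

Variable L : (B -> R) -> (B -> R).

Definition dual_operator k (Lk : dualsum k -> dualsum k) :=
  linear_on (@Dsum k) Lk /\
  forall a, Dsum a -> forall y, S y -> L (polyf a) y = dotp (Lk a) (bar y).

Definition bidual_dom k : set (bidualsum k) :=
  span [set (bar y : bidualsum k) | y in [set y | S y /\ exists C : R,
    forall (i : 'I_k.+1) (a : dual (symtensor (N i))), Dpow a ->
      `|L (monof a) y| <= C * `|a|]].

Definition bidual_operator k (Mk : bidualsum k -> bidualsum k) :=
  linear_on (@bidual_dom k) Mk /\
  forall y, S y -> @bidual_dom k (bar y) ->
    forall a, Dsum a -> L (polyf a) y = dotp a (Mk (bar y)).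

(* The integral on the right is required to exist. *)
Definition weak_solution k (H : set (dualsum k)) (Lk : dualsum k -> dualsum k)
    (m0 : bidualsum k) (m : R -> bidualsum k) :=
  forall (t : R) a, 0 < t -> H a ->
    lebesgue_measure.-integrable `[0, t] (fun s => (dotp (Lk a) (m s))%:E) /\
    dotp a (m t) =
      dotp a m0 + \int[lebesgue_measure]_(s in `[0, t]) dotp (Lk a) (m s).

End Polynomials.

Arguments Dsum {R B} N D k _ : rename.

Section Processes.
Context {R : realType} {d : measure_display} {Omega : measurableType d}.
Variables (P : probability Omega R) (F : R -> set (set Omega)).
Implicit Types (M X Z : R -> Omega -> R) (f : Omega -> R).

Definition filtration :=
  [/\ forall t, 0 <= t -> sigma_algebra setT (F t),
      forall t, 0 <= t -> F t `<=` measurable &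
      forall s t, 0 <= s -> s <= t -> F s `<=` F t].

Definition measurable_wrt (G : set (set Omega)) f :=
  forall U : set R, measurable U -> G (f @^-1` U).

Record martingale M : Prop := {
  martingale_adapted : forall t, 0 <= t -> measurable_wrt (F t) (M t) ;
  martingale_integrable : forall t, 0 <= t ->
    P.-integrable setT (EFin \o M t) ;
  martingale_condexp : forall s t A, 0 <= s -> s <= t -> F s A ->
    \int[P]_(w in A) M t w = \int[P]_(w in A) M s w }.

Definition stopping_time (tau : Omega -> \bar R) :=
  (forall w, 0 <= tau w)%E /\
  forall t, 0 <= t -> F t [set w | (tau w <= t%:E)%E].

Definition stopped M (tau : Omega -> \bar R) : R -> Omega -> R :=
  fun t w => M (fine (mine t%:E (tau w))) w.

Definition local_martingale M := exists tau : nat -> Omega -> \bar R,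
  [/\ forall n, stopping_time (tau n),
      {ae P, forall w, nondecreasing_seq (tau ^~ w)},
      {ae P, forall w, tau n w @[n --> \oo] --> +oo%E} &
      forall n, martingale (stopped M (tau n))].

Definition version X Y := forall t, 0 <= t -> {ae P, forall w, X t w = Y t w}.

Definition cadlag X := forall w,
  (forall t, 0 <= t -> X s w @[s --> t^'+] --> X t w) /\
  (forall t, 0 < t -> cvg (X s w @[s --> t^'-])).

Definition compensated X Z : R -> Omega -> R :=
  fun t w => X t w - X 0 w - \int[lebesgue_measure]_(s in `[0, t]) Z s w.

Context {B : normedModType R} (N : forall j, crossnorm B j).
Variables (D : set (dual B)) (S : set B).
Implicit Type lam : R -> Omega -> B.

Definition process lam :=
  forall n (a : dual (symtensor (N n))) t, 0 <= t ->
    measurable_wrt (F t) (fun w => a (tpow (N n) (lam t w))).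

(* N^p, with q = L p, is built from cadlag versions of p(lam) and q(lam). *)
Definition N_local_martingale lam (p q : B -> R) := exists X Z,
  [/\ version X (fun t w => p (lam t w)), cadlag X,
      version Z (fun t w => q (lam t w)), cadlag Z &
      local_martingale (compensated X Z)].

(* Outside P^D no cadlag version is available: the time integral in N^p is that
   of a version of q(lam) which is jointly measurable and integrable on
   [0, t] x Omega. Without this integrability, E[int_0^t q(lam_s) ds] and
   int_0^t E[q(lam_s)] ds may both exist and differ. *)
Definition N_true_martingale lam (p q : B -> R) := exists X Z,
  [/\ version X (fun t w => p (lam t w)),
      version Z (fun t w => q (lam t w)),
      forall t, 0 <= t ->
        (P \x lebesgue_measure)%E.-integrable (setT `*` `[0, t])
          (fun x => (Z x.2 x.1)%:E) &
      martingale (compensated X Z)].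

Record polynomial_process (L : (B -> R) -> (B -> R)) lam (y0 : B) : Prop := {
  polynomial_process_process : process lam ;
  polynomial_process_in : forall t w, 0 <= t -> S (lam t w) ;
  polynomial_process_init_in : S y0 ;
  polynomial_process_init : {ae P, forall w, lam 0 w = y0} ;
  polynomial_process_mart : forall p, Dpolys N D p ->
    N_local_martingale lam p (L p) }.

Definition is_dunford (V : normedModType R) (xi : Omega -> V)
    (m : dual (dual V)) := forall a : dual V,
  P.-integrable setT (fun w => (a (xi w))%:E) /\ \int[P]_w a (xi w) = m a.

Definition dunford_integrable (V : normedModType R) (xi : Omega -> V) :=
  (forall a : dual V, measurable_fun setT (fun w => a (xi w))) /\
  exists m, is_dunford xi m.

Definition dunford (V : normedModType R) (xi : Omega -> V) : dual (dual V) :=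
  xget 0 (is_dunford xi).

Definition moments k lam : R -> bidualsum N k :=
  fun t j => dunford (fun w => tpow (N j) (lam t w)).

End Processes.

(* Main.v *)
(* Pairing with a Dunford integral commutes with expectation, so E[p_a(lam_t)]
   equals (a . m_t) for every coefficient vector a. The martingale N^{p_a}
   vanishes at time 0, hence has expectation 0 at time t, and Fubini's theorem on
   Omega x [0, t] turns the expectation of its time integral into the integral of
   s |-> (L_k a . m_s). *)
Require Import Defs.
From HB Require Import structures.
From mathcomp Require Import all_boot all_order all_algebra.
From mathcomp Require Import all_classical all_reals all_analysis.
From mathcomp Require Import measurable_realfun.

Import Order.TTheory GRing.Theory Num.Theory.
Import numFieldNormedType.Exports.

Local Open Scope classical_set_scope.
Local Open Scope ring_scope.

(** * Null-set modifications and real-valued integrals *)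

Section IntegralVersions.
Context {d : measure_display} {T : measurableType d} {R : realType}.
Context {mu : {measure set T -> \bar R}}.

(** Measurability of [g] is a separate hypothesis because [mu] need not be complete. *)
Lemma integrable_ae_eq {D : set T} {f g : T -> \bar R} : measurable D ->
  measurable_fun D g -> ae_eq mu D f g ->
  mu.-integrable D f -> mu.-integrable D g.
Proof.
move=> mD mg fg /integrableP[mf fi]; apply/integrableP; split => //.
rewrite -(@ae_eq_integral _ _ _ mu D (fun x => `|g x|)%E (fun x => `|f x|)%E) //.
- exact: measurableT_comp.
- exact: measurableT_comp.
- by apply: filterS fg => x fgx Dx /=; rewrite fgx.
Qed.

Lemma integrable_fine {D : set T} {f : T -> \bar R} : measurable D ->
  mu.-integrable D f -> mu.-integrable D (EFin \o fine \o f).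
Proof.
move=> mD fi; apply: (le_integrable mD _ _ fi).
  apply/measurable_EFinP; apply: measurableT_comp; last first.
    exact: measurable_int fi.
  exact: fine_measurable.
(* [fine] sends both infinities to 0, so the new function is dominated by [f]. *)
by move=> x _ /=; case: (f x) => [r| |] //=; rewrite normr0 leey.
Qed.

(** An integrable function is finite almost everywhere, so [fine] alters it only on a null set. *)
Lemma Rintegral_fine {D : set T} {f : T -> \bar R} : measurable D ->
  mu.-integrable D f ->
  \int[mu]_(x in D) fine (f x) = fine (\int[mu]_(x in D) f x)%E.
Proof.
move=> mD fi; congr fine; apply: ae_eq_integral => //.
- exact: measurable_int (integrable_fine mD fi).
- exact: measurable_int fi.
- by apply: filterS (integrable_ae mD fi) => x fx Dx /=; rewrite fineK// fx.
Qed.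

Lemma Rintegral_ae_eq {D : set T} {f g : T -> R} : measurable D ->
  measurable_fun D f -> measurable_fun D g -> ae_eq mu D f g ->
  \int[mu]_(x in D) f x = \int[mu]_(x in D) g x.
Proof.
move=> mD mf mg fg; congr fine; apply: ae_eq_integral => //.
- exact/measurable_EFinP.
- exact/measurable_EFinP.
- by apply: filterS fg => x fgx Dx; rewrite fgx.
Qed.

Lemma integrable_Rsum {I : Type} (s : seq I) {D : set T} (f : I -> T -> R) :
  measurable D -> (forall i, mu.-integrable D (EFin \o f i)) ->
  mu.-integrable D (fun x => (\sum_(i <- s) f i x)%:E).
Proof.
move=> mD fi.
under eq_fun do rewrite -sumEFin.
by apply: integrable_sum => // i _; exact: fi.
Qed.

Lemma Rintegral_sum {I : Type} (s : seq I) {D : set T} (f : I -> T -> R) :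
  measurable D -> (forall i, mu.-integrable D (EFin \o f i)) ->
  \int[mu]_(x in D) (\sum_(i <- s) f i x) =
  \sum_(i <- s) \int[mu]_(x in D) f i x.
Proof.
move=> mD fi; elim: s => [|i s ih].
  rewrite big_nil; under eq_Rintegral do rewrite big_nil.
  by rewrite Rintegral_cst// mul0r.
rewrite big_cons -ih -RintegralD//; last exact: integrable_Rsum.
by under eq_Rintegral do rewrite big_cons.
Qed.

End IntegralVersions.

(** * Fubini's theorem on a strip *)

Lemma integrable_fubini_G {d1 d2 : measure_display} {T1 : measurableType d1}
    {T2 : measurableType d2} {R : realType}
    {m1 : {sigma_finite_measure set T1 -> \bar R}}
    {m2 : {sigma_finite_measure set T2 -> \bar R}} {f : T1 * T2 -> \bar R} :
  (m1 \x m2)%E.-integrable setT f -> m2.-integrable setT (fubini_G m1 f).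
Proof.
move=> fi; have mf := measurable_int _ fi; have mG := measurable_fubini_G fi.
apply/integrableP; split => //.
(* The modulus of an inner integral is at most the inner integral of the modulus, which reduces the
   claim to Tonelli for [|f|]. *)
apply: le_lt_trans ((integrable21ltyP m1 m2 mf).1 fi).
apply: ge0_le_integral => //; first exact: measurableT_comp.
  exact: (measurable_fun_fubini_tonelli_G (fun x => `|f x|)%E)
    (measurableT_comp _ mf) _.
by move=> y _; apply: le_abse_integral => //; apply: measurableT_comp.
Qed.

Section FubiniStrip.
Context {d1 d2 : measure_display} {T1 : measurableType d1}
  {T2 : measurableType d2} {R : realType}.
Context {m1 : {sigma_finite_measure set T1 -> \bar R}}
  {m2 : {sigma_finite_measure set T2 -> \bar R}}.
Context {I : set T2} {f : T2 -> T1 -> R}.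
Hypothesis mI : measurable I.
Hypothesis fi : (m1 \x m2)%E.-integrable (setT `*` I)
  (fun x => (f x.2 x.1)%:E).

(** Extension by zero off the strip, so that Fubini's theorem is applied on the whole product. *)
Let g : T1 * T2 -> \bar R := (fun x => (f x.2 x.1)%:E) \_ (setT `*` I).

Let mTI : measurable ([set: T1] `*` I).
Proof. exact: measurableX. Qed.

Let gi : (m1 \x m2)%E.-integrable setT g.
Proof. exact: (integrable_mkcond _ mTI).1 fi. Qed.

Let gE x y : g (x, y) = if y \in I then (f y x)%:E else 0%E.
Proof.
rewrite /g patchE; congr (if _ then _ else _); apply/idP/idP => /set_mem.
  by move=> [_ /= Iy]; exact: mem_set.
by move=> Iy; apply: mem_set; split.
Qed.

Let fubini_FE x : fubini_F m2 g x = (\int[m2]_(y in I) (f y x)%:E)%E.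
Proof.
by rewrite [RHS]integral_mkcond; apply: eq_integral => y _; rewrite gE patchE.
Qed.

Let fubini_GE y : y \in I -> fubini_G m1 g y = (\int[m1]_x (f y x)%:E)%E.
Proof. by move=> yI; apply: eq_integral => x _; rewrite gE yI. Qed.

(** Joint measurability gives this for every [y] in [I], with no exceptional null set. *)
Lemma measurable_strip_section {y} : I y -> measurable_fun setT (f y).
Proof.
move=> Iy; apply/measurable_EFinP.
have -> : EFin \o f y = g \o (fun x => (x, y)).
  by apply/funext => x /=; rewrite gE mem_set.
by apply: measurableT_comp; [exact: measurable_int gi|exact: pair2_measurable].
Qed.

(** The real inner integral is [fine] of the extended one: it takes the value 0 on the null set of
    [x] whose section is not integrable. *)
Lemma integrable_strip1 :
  m1.-integrable setT (fun x => (\int[m2]_(y in I) f y x)%:E).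
Proof.
have := integrable_fine measurableT (integrable_fubini_F gi).
by congr integrable; apply/funext => x /=; rewrite fubini_FE.
Qed.

Lemma integrable_strip2 :
  m2.-integrable I (fun y => (\int[m1]_x f y x)%:E).
Proof.
have /(integrableS measurableT mI (@subsetT _ _)) :=
  integrable_fine measurableT (integrable_fubini_G gi).
by apply: eq_integrable => // y yI /=; rewrite fubini_GE.
Qed.

Lemma Rintegral_strip : \int[m1]_x (\int[m2]_(y in I) f y x) =
  \int[m2]_(y in I) (\int[m1]_x f y x).
Proof.
transitivity (fine (\int[m1]_x fubini_F m2 g x)).
  rewrite -Rintegral_fine//; last exact: integrable_fubini_F.
  by apply: eq_Rintegral => x _; rewrite fubini_FE.
(* The exchange itself takes place between extended-real integrals; both ends only commute [fine]
   with the outer integral. *)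
transitivity (fine (\int[m2]_y fubini_G m1 g y)).
  by rewrite integral12_prod_meas1// integral21_prod_meas1.
rewrite -Rintegral_fine//; last exact: integrable_fubini_G.
rewrite /Rintegral [in RHS]integral_mkcond; congr fine.
apply: eq_integral => y _; rewrite patchE; case: ifPn => yI.
  by rewrite fubini_GE.
by rewrite /fubini_G; under eq_integral do rewrite gE (negPf yI); rewrite integral0.
Qed.

End FubiniStrip.

(** * Dunford integrals and expectations of polynomials *)

Section DunfordMoments.
Context {R : realType} {d : measure_display} {Omega : measurableType d}.
Context {P : probability Omega R}.

Lemma dunfordP {V : normedModType R} {xi : Omega -> V} :
  dunford_integrable P xi -> is_dunford P xi (dunford P xi).
Proof. by move=> [_ xi_m]; exact: xgetPex. Qed.

Lemma is_dunford_unique {V : normedModType R} {xi : Omega -> V}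
    {m n : dual (dual V)} : is_dunford P xi m -> is_dunford P xi n -> m = n.
Proof. by move=> xm xn; apply: dualP => a; rewrite -(xm a).2 (xn a).2. Qed.

(** Meant for time 0, where the process is almost surely constant and Dunford integrability has to
    be proved. *)
Lemma is_dunford_ae_cst {V : normedModType R} {xi : Omega -> V} {v : V} :
  (forall a : dual V, measurable_fun setT (fun w => a (xi w))) ->
  {ae P, forall w, xi w = v} -> is_dunford P xi (bidual_emb v).
Proof.
move=> mxi xiv a; split.
  apply: (integrable_ae_eq (f := cst (a v)%:E)) => //.
  - exact/measurable_EFinP.
  - by apply: filterS xiv => w -> _.
  - exact: finite_measure_integrable_cst.
rewrite (Rintegral_ae_eq (g := cst (a v))) //.
  by rewrite Rintegral_cst//= probability_setT mulr1.
by apply: filterS xiv => w -> _.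
Qed.

Context {B : normedModType R} (N : forall j, crossnorm B j).

Lemma expectation_polyf {k : nat} (a : dualsum N k) {xi : Omega -> B}
    {m : bidualsum N k} :
  (forall j : 'I_k.+1, is_dunford P (fun w => tpow (N j) (xi w)) (m j)) ->
  P.-integrable setT (fun w => (polyf a (xi w))%:E) /\
  \int[P]_w polyf a (xi w) = dotp a m.
Proof.
move=> xim; split.
  by apply: integrable_Rsum => // j; exact: (xim j (a j)).1.
rewrite /polyf /dotp Rintegral_sum//; last by move=> j; exact: (xim j (a j)).1.
by apply: eq_bigr => j _; exact: (xim j (a j)).2.
Qed.

End DunfordMoments.

(** * Moments of the process and expectations of versions *)

Section ProcessMoments.
Context {R : realType} {d : measure_display} {Omega : measurableType d}.
Context {P : probability Omega R} {F : R -> set (set Omega)}.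
Hypothesis F_filtration : filtration F.

Lemma measurable_wrt_measurable {t : R} {f : Omega -> R} : 0 <= t ->
  measurable_wrt (F t) f -> measurable_fun setT f.
Proof.
by have [_ Fm _] := F_filtration => t0 mf _ U mU; rewrite setTI; exact/Fm/mf.
Qed.

Context {B : normedModType R} {N : forall j, crossnorm B j} {k : nat}
  {lam : R -> Omega -> B} {y0 : B}.
Hypothesis lam_process : process F N lam.
Hypothesis lam_init : {ae P, forall w, lam 0 w = y0}.

Let tpow0 (j : 'I_k.+1) :
  is_dunford P (fun w => tpow (N j) (lam 0 w)) (bar N y0 j).
Proof.
apply: is_dunford_ae_cst => [a|].
  exact: measurable_wrt_measurable (lexx 0) (lam_process _ a _ (lexx 0)).
by apply: filterS lam_init => w ->.
Qed.

(** [dunford] picks some Dunford integral; uniqueness identifies it with the canonical image of the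
    power of [y0]. *)
Lemma moments0 : moments P N lam 0 = bar N y0 :> bidualsum N k.
Proof.
apply: functional_extensionality_dep => j.
apply: is_dunford_unique (tpow0 j); apply: xgetPex.
by exists (bar N y0 j); exact: tpow0.
Qed.

Hypothesis lam_dunford : forall (j : 'I_k.+1) (t : R), 0 < t ->
  dunford_integrable P (fun w => tpow (N j) (lam t w)).

Lemma is_dunford_moments {t : R} (j : 'I_k.+1) : 0 <= t ->
  is_dunford P (fun w => tpow (N j) (lam t w))
    ((moments P N lam t : bidualsum N k) j).
Proof.
rewrite le_eqVlt => /predU1P[<-|t0]; first by rewrite moments0; exact: tpow0.
exact/dunfordP/lam_dunford.
Qed.

(** Serves for the time integrand [Z], whose sections are measurable by joint measurability. *)
Lemma expectation_version {p : dualsum N k} {Y : R -> Omega -> R} {t : R} :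
  0 <= t -> version P Y (fun t w => polyf p (lam t w)) ->
  measurable_fun setT (Y t) ->
  \int[P]_w Y t w = dotp p (moments P N lam t).
Proof.
move=> t0 YV mY.
have [pi <-] := expectation_polyf N p (fun j => is_dunford_moments j t0).
apply: Rintegral_ae_eq => //.
  by apply/measurable_EFinP; exact: measurable_int pi.
by apply: filterS (YV t t0) => w -> _.
Qed.

(* A version of p(lam) need not be measurable, as P is not assumed complete;
   for [compensated X Z] only the increments of X turn out to be. *)
Lemma expectation_version_increment {p : dualsum N k}
    {Y : R -> Omega -> R} {t : R} :
  0 <= t -> version P Y (fun t w => polyf p (lam t w)) ->
  measurable_fun setT (fun w => Y t w - Y 0 w) ->
  P.-integrable setT (fun w => (Y t w - Y 0 w)%:E) /\
  \int[P]_w (Y t w - Y 0 w) = dotp p (moments P N lam t) - dotp p (bar N y0).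
Proof.
move=> t0 YV mY.
have [pi <-] := expectation_polyf N p (fun j => is_dunford_moments j t0).
have [pi0] := expectation_polyf N p (fun j => is_dunford_moments j (lexx 0)).
rewrite moments0 => <-.
have inc : ae_eq P setT (fun w => polyf p (lam t w) - polyf p (lam 0 w))
    (fun w => Y t w - Y 0 w).
  by apply: filterS2 (YV t t0) (YV 0 (lexx 0)) => w -> -> _.
have di : P.-integrable setT
    (EFin \o (fun w => polyf p (lam t w) - polyf p (lam 0 w))).
  exact: (integrableB measurableT pi pi0).
split.
  apply: integrable_ae_eq di => //; first exact/measurable_EFinP.
  by apply: filterS inc => w /= /[apply] ->.
rewrite -RintegralB//; apply/esym/Rintegral_ae_eq => //.
by apply/measurable_EFinP; exact: measurable_int di.
Qed.

End ProcessMoments.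

(** * The weak equation for the moments *)

Theorem theorem3p8 (R : realType) (B : completeNormedModType R)
  (N : forall j, crossnorm B j)
  (D : set (dual B)) (D_subspace : is_subspace D)
  (S : set B)
  (L : (B -> R) -> (B -> R)) (L_S_polynomial : S_polynomial N D S L)
  (k : nat) (k_gt0 : (0 < k)%N)
  (Lk : dualsum N k -> dualsum N k) (Lk_dual : dual_operator D S L Lk)
  (Mk : bidualsum N k -> bidualsum N k) (Mk_bidual : bidual_operator D S L Mk)
  (Lk_closable : closable (Dsum N D k) Lk)
  (d : measure_display) (Omega : measurableType d) (P : probability Omega R)
  (F : R -> set (set Omega)) (F_filtration : filtration F)
  (lam : R -> Omega -> B) (y0 : B)
  (lam_polynomial : polynomial_process P F N D S L lam y0)
  (lam_dunford : forall (j : 'I_k.+1) (t : R), 0 < t ->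
    dunford_integrable P (fun w => tpow (N j) (lam t w))) :
  let Lk_dom := closure_dom (Dsum N D k) Lk in
  let Lk_bar := closure_op (Dsum N D k) Lk in
  let E := [set a : dualsum N k | Lk_dom a /\
             N_true_martingale P F lam (polyf a) (polyf (Lk_bar a))] in
  weak_solution E Lk_bar (bar N y0) (moments P N lam).
Proof.
move=> Lk_dom Lk_bar E t a t_gt0 [_ [X [Z [XV ZV Zi [_ Ni Ncond]]]]].
have t_ge0 := ltW t_gt0.
have [lam_process _ _ lam_init _] := lam_polynomial.
(* Without the annotation, the interval would get the default display of R
   instead of the one carried by [lebesgue_measure]. *)
have mI : measurable
    (`[0, t]%classic : set (g_sigma_algebraType R.-ocitv.-measurable)) by [].
have Zt := Zi t t_ge0.
(* This holds at every [s] in the interval: a version agrees almost surely at each fixed time. *)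
have EZ s : `[0, t]%classic s ->
    \int[P]_w Z s w = dotp (Lk_bar a) (moments P N lam s).
  move=> st; apply: (expectation_version F_filtration lam_process lam_init) => //.
    by move: st; rewrite /= in_itv/= => /andP[].
  by have := measurable_strip_section mI Zt st.
split.
  (* The integral on the right of the weak equation exists because Fubini makes the expectation of
     [Z s] integrable in [s]. *)
  apply: eq_integrable (integrable_strip2 mI Zt) => // s.
  by move=> /set_mem st /=; rewrite EZ.
pose J w := \int[lebesgue_measure]_(s in `[0, t]) Z s w.
have Ji : P.-integrable setT (EFin \o J).
  exact: integrable_strip1 mI Zt.
(* The increment of [X] is a sum of two integrable functions, hence measurable. *)
have incE : (fun w => X t w - X 0 w) = (fun w => compensated X Z t w + J w).
  by apply/funext => w; rewrite /compensated subrK.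
have [|inci EX] := expectation_version_increment F_filtration lam_process
    lam_init lam_dunford t_ge0 XV.
  rewrite incE; apply: measurable_funD; apply/measurable_EFinP.
    exact: measurable_int (Ni t t_ge0).
  exact: measurable_int Ji.
have N0 : \int[P]_w compensated X Z t w = 0.
  have [/(_ 0 (lexx 0))[F0 FC _] _ _] := F_filtration.
  (* The martingale identity between times 0 and [t] is used on the whole space, which lies in [F 0]
     as the complement of the empty set. *)
  rewrite (Ncond 0) //; last by rewrite -(setD0 setT); exact: FC.
  transitivity (\int[P]_w (cst 0 w : R)); last by rewrite Rintegral_cst// mul0r.
  apply: eq_Rintegral => w _.
  (* At time 0 the time integral runs over the single point 0, so the compensated process vanishes
     at every [w]. *)
  by rewrite /compensated set_itv1 Rintegral_set1 !subrr.
have EJ : \int[P]_w J w =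
    \int[lebesgue_measure]_(s in `[0, t]) dotp (Lk_bar a) (moments P N lam s).
  rewrite (Rintegral_strip mI Zt).
  by apply: eq_Rintegral => s /set_mem; exact: EZ.
(* The increment of [(a . m)] is the expected increment of [X], that is, the expectation of the
   martingale, which is 0, plus that of [J]. *)
apply/eqP; rewrite addrC -subr_eq -EX -EJ incE RintegralD// ?N0 ?add0r//.
exact: Ni.
Qed.
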